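(* Let $\operatorname{Re} p>1$. Then for $|\operatorname{Re} b|<|\operatorname{Re} a|$, $$\int_0^\infty \frac{\cosh bx}{\sinh ax}\,x^{p-1}\,dx=\frac{\Gamma(p)}{(2a)^p}\left[\zeta\!\left(p,\frac{a-b}{2a}\right)+\zeta\!\left(p,\frac{a+b}{2a}\right)\right].$$
   Context: $\Gamma$ is the Gamma function. $\zeta(s,c)$ is the (analytically continuable) Hurwitz zeta function, given by $\zeta(s,c)=\sum_{n=0}^\infty (n+c)^{-s}$ for $\operatorname{Re} s>1$.
   Formalization: The condition Re a > 0 is added, with principal powers: for Re a < 0 the formula fails (p=2, a=-1, b=0 gives -π²/4 on the left, +π²/4 on the right); for odd integer p the case Re a < 0 follows by replacing a with -a. *)

(* Defs.v *)
From Stdlib Require Export Reals.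
From Coquelicot Require Export Coquelicot.

Open Scope R_scope.

Definition Cexp (z : C) : C :=
  (exp (Re z) * cos (Im z), exp (Re z) * sin (Im z)).

Definition Ccosh (z : C) : C := ((Cexp z + Cexp (- z)) / 2)%C.
Definition Csinh (z : C) : C := ((Cexp z - Cexp (- z)) / 2)%C.

(* Principal argument, with values in (-PI, PI] for z <> 0. *)
Definition Carg (z : C) : R :=
  if Rle_dec 0 (Im z) then acos (Re z / Cmod z) else - acos (Re z / Cmod z).

Definition Clog (z : C) : C := (ln (Cmod z), Carg z).

(* Principal branch of z ^ w; meaningful only for z <> 0. *)
Definition Cpower (z w : C) : C := Cexp (w * Clog z)%C.

(* Euler's integral; it converges, and is the Gamma function, for 0 < Re s.
   C is regarded as a complete normed space over R. *)
Definition CGamma (s : C) : C :=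
  RInt_gen (V := C_R_CompleteNormedModule)
    (fun t : R => (Cpower (RtoC t) (s - 1) * Cexp (- RtoC t))%C)
    (at_right 0) (Rbar_locally p_infty).

(* The sum of the series (n + c) ^ (- s); this is the Hurwitz zeta function for
   1 < Re s and c not a nonpositive integer.  As [iota] returns an unspecified
   value when the series diverges, the analytic continuation is not covered. *)
Definition Hurwitz_zeta (s c : C) : C :=
  iota (T := C_R_CompleteNormedModule)
    (is_series (V := C_R_NormedModule)
       (fun n : nat => Cpower (RtoC (INR n) + c) (- s))).

(* Main.v *)
(* Expand [cosh bx / sinh ax] as the sum of the two geometric series
   [sum_n e^(-(w + 2 a n) x)], [w = a - b] and [w = a + b].  Each term integrates to
   [Gamma(p) (w + 2 a n)^(-p)]; for complex [w] this is Euler's integral on a rotated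
   ray, and the rotation is a homotopy argument on the finite intervals [u, v] whose
   boundary terms vanish in the limit.  The remainder after [N] terms is dominated by
   [O(N^(-e))] times one fixed integrable function, where [e = (Re p - 1) / 2], which
   replaces any interchange theorem for sums and integrals.  Finally
   [(w + 2 a n)^(-p) = (2 a)^(-p) (n + w / (2 a))^(-p)] because [w + 2 a n] and [2 a]
   both lie in the right half-plane. *)
Require Import Defs.
From Stdlib Require Import Reals Lra Psatz.
From Coquelicot Require Import Coquelicot.

(** * Complex exponential, logarithm and powers *)

(** Since [1 / (1 - e^(-2ax))] has a simple pole at [x = 0], the integrand is only [O(x^(Re p - 2))]
    there, and [Re p - 2 = 2e - 1]. Half of the surplus [2e] over the critical exponent [-1] pays
    for integrability at [0], the other half for the decay [N^(-e)]; this is how [1 < Re p] enters.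
    The dominating function has an explicit bounded antiderivative, so that one pointwise bound
    yields both the convergence of an improper integral and the size of its value. The mean value
    theorem does not hold for complex-valued functions, so the rotation is carried out on real
    combinations [c Re + d Im] of the integrand. [CGamma] and [Hurwitz_zeta] select a limit if there
    is one; each therefore requires a proof of convergence before its value can be used. *)

Lemma Cexp_plus (z w : C) : Cexp (z + w) = (Cexp z * Cexp w)%C.
Proof.
destruct z as [x y], w as [u v]; unfold Cexp, Cmult; simpl.
rewrite exp_plus, cos_plus, sin_plus; f_equal; ring.
Qed.

Lemma Cexp_0 : Cexp 0 = 1%C.
Proof. unfold Cexp; simpl; rewrite exp_0, cos_0, sin_0; unfold RtoC; f_equal; ring. Qed.

Lemma Cmod_Cexp (z : C) : Cmod (Cexp z) = exp (Re z).
Proof.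
unfold Cexp, Cmod; simpl.
replace (_ + _) with (exp (Re z) * exp (Re z) * (Rsqr (sin (Im z)) + Rsqr (cos (Im z))))
  by (unfold Rsqr; ring).
rewrite sin2_cos2, Rmult_1_r.
apply sqrt_square, Rlt_le, exp_pos.
Qed.

Lemma Cexp_neq_0 (z : C) : Cexp z <> 0%C.
Proof. apply Cmod_gt_0; rewrite Cmod_Cexp; apply exp_pos. Qed.

Lemma Cexp_opp (z : C) : Cexp (- z) = (/ Cexp z)%C.
Proof.
assert (H : (Cexp (- z) * Cexp z)%C = 1%C).
{ rewrite <- Cexp_plus, <- Cexp_0; f_equal; ring. }
rewrite <- (Cmult_1_l (/ Cexp z)%C), <- H; field; apply Cexp_neq_0.
Qed.

Lemma Re_div_Cmod_bound (z : C) : z <> 0%C -> -1 <= Re z / Cmod z <= 1.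
Proof.
intros Hz; apply Cmod_gt_0 in Hz.
apply Rabs_le_between.
unfold Rdiv; rewrite Rabs_mult, (Rabs_pos_eq (/ Cmod z)) by (left; now apply Rinv_0_lt_compat).
apply Rmult_le_reg_r with (Cmod z); trivial.
rewrite Rmult_assoc, Rinv_l, Rmult_1_r, Rmult_1_l by lra.
apply re_le_Cmod.
Qed.

Lemma cos_Carg (z : C) : z <> 0%C -> cos (Carg z) = Re z / Cmod z.
Proof.
intros Hz; unfold Carg.
destruct (Rle_dec 0 (Im z)); rewrite ?cos_neg; apply cos_acos, Re_div_Cmod_bound; trivial.
Qed.

(** [acos] forgets the sign of [Im z]: [sqrt (1 - (Re z / Cmod z)^2)] is [|Im z| / Cmod z], and the
    two branches of [Carg] restore the sign. *)
Lemma sin_Carg (z : C) : z <> 0%C -> sin (Carg z) = Im z / Cmod z.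
Proof.
intros Hz; pose proof (Re_div_Cmod_bound z Hz) as Hb.
assert (Hm := proj1 (Cmod_gt_0 z) Hz).
assert (E : sqrt (1 - (Re z / Cmod z)²) = Rabs (Im z) / Cmod z).
{ rewrite <- (Rabs_pos_eq (Cmod z)) at 2 by lra.
  rewrite <- Rabs_div by lra.
  rewrite <- sqrt_Rsqr_abs; f_equal.
  pose proof (Cmod2_alt z) as H2; unfold Rsqr.
  replace 1 with ((Cmod z ^ 2) / (Cmod z ^ 2)) by (field; lra).
  rewrite H2 at 1; field; lra. }
unfold Carg.
destruct (Rle_dec 0 (Im z)) as [H|H].
- rewrite sin_acos, E, Rabs_pos_eq; trivial.
- rewrite sin_neg, sin_acos, E, Rabs_left by (trivial; lra); field; lra.
Qed.

Lemma Carg_bound (z : C) : Rabs (Carg z) <= PI.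
Proof.
pose proof (acos_bound (Re z / Cmod z)).
unfold Carg; destruct (Rle_dec 0 (Im z)); apply Rabs_le; lra.
Qed.

(** The cosine of the argument is [Re z / Cmod z > 0], while cosine is nonpositive on [[PI/2, PI]].
    This bound excludes branch jumps in quotients and keeps the rotated ray inside the half-plane of
    decay. *)
Lemma Carg_right_half_plane (z : C) : 0 < Re z -> Rabs (Carg z) < PI / 2.
Proof.
intros Hz.
assert (Hz0 : z <> 0%C) by (intros ->; simpl in Hz; lra).
assert (Hm := proj1 (Cmod_gt_0 z) Hz0).
pose proof (cos_Carg z Hz0) as Hc.
assert (0 < cos (Carg z)) by (rewrite Hc; now apply Rdiv_lt_0_compat).
pose proof (Carg_bound z) as Hb.
destruct (Rlt_le_dec (Rabs (Carg z)) (PI / 2)) as [?|Hge]; trivial.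
pose proof PI_RGT_0.
assert (cos (Rabs (Carg z)) <= 0) by (apply cos_le_0; lra).
assert (cos (Rabs (Carg z)) = cos (Carg z)).
{ unfold Rabs; destruct (Rcase_abs _); rewrite ?cos_neg; trivial. }
lra.
Qed.

Lemma Cexp_Clog (z : C) : z <> 0%C -> Cexp (Clog z) = z.
Proof.
intros Hz; assert (Hm := proj1 (Cmod_gt_0 z) Hz).
unfold Cexp, Clog; simpl.
rewrite exp_ln, cos_Carg, sin_Carg by trivial.
destruct z as [x y]; simpl; f_equal; field; lra.
Qed.

(** For [|y| < PI], [sin y] is nonnegative exactly when [y] is, so the branch taken by [Carg]
    returns [y] itself. *)
Lemma Clog_Cexp (z : C) : Rabs (Im z) < PI -> Clog (Cexp z) = z.
Proof.
intros Hz; apply Rabs_lt_between in Hz.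
unfold Clog, Carg; rewrite Cmod_Cexp, ln_exp.
destruct z as [x y]; unfold Cexp; simpl in *; f_equal.
pose proof (exp_pos x) as Hx.
replace (exp x * cos y / exp x) with (cos y) by (field; lra).
destruct (Rle_dec 0 (exp x * sin y)) as [H|H].
- apply acos_cos; split; try lra.
  destruct (Rle_lt_dec 0 y) as [?|Hy]; trivial.
  assert (0 < sin (- y)) by (apply sin_gt_0; lra).
  rewrite sin_neg in *; nra.
- destruct (Rlt_le_dec y 0) as [?|Hy].
  + rewrite <- cos_neg, acos_cos; lra.
  + destruct H; apply Rmult_le_pos; [lra | apply sin_ge_0; lra].
Qed.

Lemma Clog_RtoC (t : R) : 0 < t -> Clog (RtoC t) = RtoC (ln t).
Proof.
intros Ht.
rewrite <- (Clog_Cexp (RtoC (ln t))) by (simpl; rewrite Rabs_R0; apply PI_RGT_0).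
f_equal; unfold Cexp, RtoC; simpl; rewrite exp_ln, cos_0, sin_0 by trivial.
f_equal; ring.
Qed.

(** Both arguments are below [PI / 2] in absolute value, so their difference stays in the strip
    where [Clog] inverts [Cexp]: no multiple of [2 i PI] appears. *)
Lemma Clog_div (z w : C) : 0 < Re z -> 0 < Re w -> Clog (z / w) = (Clog z - Clog w)%C.
Proof.
intros Hz Hw.
assert (z <> 0%C) by (intros ->; simpl in Hz; lra).
assert (w <> 0%C) by (intros ->; simpl in Hw; lra).
rewrite <- (Clog_Cexp (Clog z - Clog w)).
- unfold Cminus, Cdiv; rewrite Cexp_plus, Cexp_opp, !Cexp_Clog; trivial.
- apply Carg_right_half_plane in Hz, Hw.
  change (Rabs (Carg z + - Carg w) < PI).
  apply Rabs_lt_between in Hz, Hw; apply Rabs_lt_between; lra.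
Qed.

Lemma Cpower_div (z w s : C) : 0 < Re z -> 0 < Re w ->
  Cpower (z / w) s = (Cpower z s / Cpower w s)%C.
Proof.
intros; unfold Cpower, Cdiv at 2; rewrite Clog_div, <- Cexp_opp, <- Cexp_plus by trivial.
f_equal; ring.
Qed.

Lemma Cpower_opp (z s : C) : Cpower z (- s) = (/ Cpower z s)%C.
Proof. unfold Cpower; rewrite <- Cexp_opp; f_equal; ring. Qed.

Lemma Cpower_neq_0 (z s : C) : Cpower z s <> 0%C.
Proof. apply Cexp_neq_0. Qed.

Lemma Cmod_Cpower_RtoC (t : R) (s : C) : 0 < t ->
  Cmod (Cpower (RtoC t) s) = Rpower t (Re s).
Proof.
intros Ht; unfold Cpower, Rpower; rewrite Cmod_Cexp, Clog_RtoC by trivial.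
f_equal; destruct s; simpl; ring.
Qed.

(** * Improper integrals on the half-line *)

Lemma at_right_0_lt (d : R) : 0 < d -> at_right 0 (fun x => 0 < x < d).
Proof.
intros Hd; exists (mkposreal d Hd); intros y Hy Hy0.
apply AbsRing_norm_compat2 in Hy; simpl in Hy.
unfold ball in Hy; simpl in Hy; unfold AbsRing_ball, minus, plus, opp, abs in Hy; simpl in Hy.
split; trivial; apply Rabs_lt_between in Hy; lra.
Qed.

Lemma Rbar_locally_p_infty_lt (M : R) : Rbar_locally p_infty (fun x => M < x).
Proof. now exists M. Qed.

Lemma filter_prod_half_line (d M : R) : 0 < d ->
  filter_prod (at_right 0) (Rbar_locally p_infty) (fun ab => 0 < fst ab < d /\ M < snd ab).
Proof.
intros Hd; econstructor; [now apply (at_right_0_lt d) | apply (Rbar_locally_p_infty_lt M) |].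
now simpl.
Qed.

Lemma plus_plus_minus_cancel {G : AbelianGroup} (x y z : G) :
  minus (plus x (plus y z)) y = plus x z.
Proof.
unfold minus; rewrite (plus_comm y), plus_assoc, <- (plus_assoc _ y), plus_opp_r.
apply plus_zero_r.
Qed.

Lemma minus_minus_minus {G : AbelianGroup} (x y z : G) :
  minus (minus x z) (minus x y) = minus y z.
Proof.
unfold minus at 1; rewrite opp_minus, plus_comm; symmetry; apply minus_trans.
Qed.

Section Half_line.

Context {V : CompleteNormedModule R_AbsRing}.

Lemma ex_RInt_continuous_half_line (f : R -> V) (u v : R) :
  (forall x, 0 < x -> continuous f x) -> 0 < u -> 0 < v -> ex_RInt f u v.
Proof.
intros Hf Hu Hv; apply ex_RInt_continuous; intros x [Hx _]; apply Hf.
pose proof (Rmin_Rgt_r u v 0); lra.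
Qed.



Lemma is_RInt_gen_of_filterlim (f : R -> V) (l : V) :
  (forall x, 0 < x -> continuous f x) ->
  filterlim (fun ab => RInt f (fst ab) (snd ab))
     (filter_prod (at_right 0) (Rbar_locally p_infty)) (locally l) ->
  is_RInt_gen f (at_right 0) (Rbar_locally p_infty) l.
Proof.
intros Hf H P HP.
specialize (H P HP); unfold filtermap in H; unfold filtermapi.
generalize (filter_and _ _ H (filter_prod_half_line 1 1 Rlt_0_1)).
apply filter_imp; intros [u v] [HPl Huv]; simpl in *.
exists (RInt f u v); split; trivial.
apply (RInt_correct f), ex_RInt_continuous_half_line; trivial; lra.
Qed.

Lemma filterlim_of_is_RInt_gen (f : R -> V) (l : V) :
  is_RInt_gen f (at_right 0) (Rbar_locally p_infty) l ->
  filterlim (fun ab => RInt f (fst ab) (snd ab))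
     (filter_prod (at_right 0) (Rbar_locally p_infty)) (locally l).
Proof.
intros H P HP; specialize (H P HP); unfold filtermapi in H; unfold filtermap.
revert H; apply filter_imp; intros [u v] [y [Hy HPy]]; simpl in *.
now rewrite (is_RInt_unique _ _ _ _ Hy).
Qed.

(** The absolute value admits either order of the endpoints; in the Cauchy criterion two lower (or
    two upper) endpoints come in no particular order. *)
Lemma norm_RInt_dominated (f : R -> V) (g G : R -> R) (u v : R) :
  (forall x, 0 < x -> continuous f x) ->
  (forall x, 0 < x -> continuous g x) ->
  (forall x, 0 < x -> is_derive G x (g x)) ->
  (forall x, 0 < x -> norm (f x) <= g x) ->
  0 < u -> 0 < v -> norm (RInt f u v) <= Rabs (G v - G u).
Proof.
intros Hf Hg HG Hfg.
assert (Hle : forall u v, 0 < u -> u <= v -> norm (RInt f u v) <= G v - G u).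
{ intros u0 v0 Hu Huv; apply (norm_RInt_le f g u0 v0); trivial.
  - intros x Hx; apply Hfg; lra.
  - apply (RInt_correct f), ex_RInt_continuous_half_line; trivial; lra.
  - apply (is_RInt_derive G g); intros x; rewrite Rmin_left by trivial;
      intros Hx; [apply HG | apply Hg]; lra. }
intros Hu Hv; destruct (Rle_lt_dec u v) as [H|H].
- eapply Rle_trans; [now apply Hle | apply Rle_abs].
- rewrite <- opp_RInt_swap by (apply ex_RInt_continuous_half_line; trivial).
  rewrite Rabs_minus_sym; eapply Rle_trans; [apply Req_le, (@norm_opp _ V) |].
  eapply Rle_trans; [apply Hle; lra | apply Rle_abs].
Qed.

(** Cauchy criterion: the integrals over [[u, v]] and [[u', v']] differ by those over the end pieces
    [[u', u]] and [[v, v']], which are bounded by increments of [G]; these are small because [G] has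
    a limit at each end. *)
Lemma is_RInt_gen_dominated (f : R -> V) (g G : R -> R) (La Lb : R) :
  (forall x, 0 < x -> continuous f x) ->
  (forall x, 0 < x -> continuous g x) ->
  (forall x, 0 < x -> is_derive G x (g x)) ->
  (forall x, 0 < x -> norm (f x) <= g x) ->
  filterlim G (at_right 0) (locally La) ->
  filterlim G (Rbar_locally p_infty) (locally Lb) ->
  exists l, is_RInt_gen f (at_right 0) (Rbar_locally p_infty) l /\ norm l <= Lb - La.
Proof.
intros Hf Hg HG Hfg Ha Hb.
assert (Hex : exists l, is_RInt_gen f (at_right 0) (Rbar_locally p_infty) l).
{ destruct (proj1 (filterlim_locally_cauchy
    (F := filter_prod (at_right 0) (Rbar_locally p_infty))
    (fun ab => RInt f (fst ab) (snd ab)))) as [l Hl].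
  2: exists l; now apply is_RInt_gen_of_filterlim.
  intros eps.
  destruct (proj2 (filterlim_locally_cauchy G) (ex_intro _ La Ha) (pos_div_2 eps)) as [Pa [HPa HPa']].
  destruct (proj2 (filterlim_locally_cauchy G) (ex_intro _ Lb Hb) (pos_div_2 eps)) as [Pb [HPb HPb']].
  exists (fun ab => (Pa (fst ab) /\ 0 < fst ab < 1) /\ Pb (snd ab) /\ 1 < snd ab); split.
  - econstructor.
    + apply (filter_and _ _ HPa (at_right_0_lt 1 Rlt_0_1)).
    + apply (filter_and _ _ HPb (Rbar_locally_p_infty_lt 1)).
    + now intros x y Hx Hy.
  - intros [u v] [u' v'] [[Hu Hu0] [Hv Hv0]] [[Hu' Hu0'] [Hv' Hv0']]; simpl in *.
    apply (@norm_compat1 _ V).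
    assert (HI : forall s t, 0 < s -> 0 < t -> ex_RInt f s t)
      by (intros; now apply ex_RInt_continuous_half_line).
    assert (E : minus (RInt f u' v') (RInt f u v) = plus (RInt f u' u) (RInt f v v')).
    { rewrite <- (RInt_Chasles f u' u v') by (apply HI; lra).
      rewrite <- (RInt_Chasles f u v v') by (apply HI; lra).
      apply (@plus_plus_minus_cancel V). }
    eapply Rle_lt_trans; [apply Req_le, f_equal, E |].
    eapply Rle_lt_trans; [apply (@norm_triangle _ V) |].
    pose proof (norm_RInt_dominated f g G u' u Hf Hg HG Hfg ltac:(lra) ltac:(lra)) as H1.
    pose proof (norm_RInt_dominated f g G v v' Hf Hg HG Hfg ltac:(lra) ltac:(lra)) as H2.
    pose proof (HPa' _ _ Hu' Hu) as H3; pose proof (HPb' _ _ Hv Hv') as H4.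
    unfold ball in H3, H4; simpl in H3, H4.
    unfold AbsRing_ball, minus, plus, opp, abs in H3, H4; simpl in H3, H4.
    unfold Rminus in H1, H2; lra. }
destruct Hex as [l Hl]; exists l; split; trivial.
apply (RInt_gen_norm (Fa := at_right 0) (Fb := Rbar_locally p_infty) f g); trivial.
- generalize (filter_prod_half_line 1 1 Rlt_0_1); apply filter_imp; intros; lra.
- generalize (filter_prod_half_line 1 1 Rlt_0_1); apply filter_imp.
  intros [u v]; simpl; intros; apply Hfg; lra.
- intros P HP.
  assert (H : filterlim (fun ab => G (snd ab) - G (fst ab))
     (filter_prod (at_right 0) (Rbar_locally p_infty)) (locally (Lb - La))).
  { apply (filterlim_comp_2 (G := locally Lb) (H := locally (opp La))
      (fun ab : R * R => G (snd ab)) (fun ab => opp (G (fst ab))) plus).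
    - eapply filterlim_comp; [apply filterlim_snd | apply Hb].
    - eapply filterlim_comp; [apply (filterlim_comp _ _ _ fst G _ _ _ filterlim_fst Ha) |].
      apply (filterlim_opp La).
    - apply (filterlim_plus Lb (opp La)). }
  specialize (H P HP); unfold filtermap in H; unfold filtermapi.
  generalize (filter_and _ _ H (filter_prod_half_line 1 1 Rlt_0_1)).
  apply filter_imp; intros [u v]; simpl; intros [HPx Huv].
  exists (G v - G u); split; trivial.
  apply (is_RInt_derive G g); intros x; rewrite Rmin_left by lra;
    intros Hx; [apply HG | apply Hg]; lra.
Qed.

Lemma is_RInt_gen_close (f h : R -> V) (K : R) (l : V) :
  (forall x, 0 < x -> continuous f x) ->
  (forall x, 0 < x -> continuous h x) ->
  (forall u v, 0 < u < v -> norm (minus (RInt f u v) (RInt h u v)) <= K * (u + / v)) ->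
  is_RInt_gen f (at_right 0) (Rbar_locally p_infty) l ->
  is_RInt_gen h (at_right 0) (Rbar_locally p_infty) l.
Proof.
intros Hf Hh Hfh Hl; apply is_RInt_gen_of_filterlim; trivial.
apply filterlim_of_is_RInt_gen in Hl.
apply (filterlim_locally_ball_norm (U := V)); intros eps.
(* [K] may be zero or negative; [K'] can be divided by. Keeping [u] and [/ v] below [eps / (4 K')]
   costs [eps / 2] in all. *)
set (K' := Rmax K 1).
assert (HK : 1 <= K') by apply Rmax_r; assert (HK1 : K <= K') by apply Rmax_l.
assert (He : 0 < eps / (4 * K')) by (apply Rdiv_lt_0_compat; [apply cond_pos | lra]).
pose proof (proj1 (filterlim_locally_ball_norm (U := V) _ _) Hl (pos_div_2 eps)) as H1.
generalize (filter_and _ _ H1 (filter_prod_half_line _ (1 + / (eps / (4 * K'))) He)).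
clear H1; generalize (filter_prod_half_line 1 1 Rlt_0_1); intros H0 H1.
generalize (filter_and _ _ H0 H1); clear H0 H1.
apply filter_imp; intros [u v]; simpl; intros [H1 [H2 H3]].
specialize (Hfh u v ltac:(lra)).
unfold ball_norm in *; simpl in *.
eapply Rle_lt_trans;
  [apply Req_le, f_equal, eq_sym, (@minus_minus_minus V (RInt f u v)) |].
eapply Rle_lt_trans; [apply (@norm_triangle _ V) |].
eapply Rle_lt_trans; [apply Rplus_le_compat_l, Req_le, (@norm_opp _ V) |].
assert (Hv : / v < eps / (4 * K')).
{ rewrite <- (Rinv_inv (eps / (4 * K'))); apply Rinv_lt_contravar; [|lra].
  apply Rmult_lt_0_compat; [now apply Rinv_0_lt_compat | lra]. }
assert (0 < / v) by (apply Rinv_0_lt_compat; lra).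
assert (K * (u + / v) <= K' * (u + / v)) by (apply Rmult_le_compat_r; lra).
assert (K' * (u + / v) < K' * (eps / (4 * K') + eps / (4 * K')))
  by (apply Rmult_lt_compat_l; lra).
replace (K' * (eps / (4 * K') + eps / (4 * K'))) with (eps / 2) in * by (field; lra).
eapply Rle_lt_trans; [apply Rplus_le_compat; [apply Rlt_le, H2 | apply Hfh] |].
lra.
Qed.

End Half_line.

(** * Continuity and domination of complex integrands *)

Notation continuousC f x := (continuous (T := R_UniformSpace) (U := C_R_NormedModule) f x).

Lemma continuousC_pair (f : R -> C) (x : R) :
  continuousC f x <-> continuous (fun t => Re (f t)) x /\ continuous (fun t => Im (f t)) x.
Proof.
split.
- intros H; split.
  + apply (continuous_comp (V := C_R_NormedModule) f Re); trivial.
    apply (continuous_fst (U := R_UniformSpace) (V := R_UniformSpace)).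
  + apply (continuous_comp (V := C_R_NormedModule) f Im); trivial.
    apply (continuous_snd (U := R_UniformSpace) (V := R_UniformSpace)).
- intros [H1 H2]; apply filterlim_locally; intros eps.
  generalize (filter_and _ _ (proj1 (filterlim_locally _ _) H1 eps)
                             (proj1 (filterlim_locally _ _) H2 eps)).
  now apply filter_imp.
Qed.

Lemma continuousC_const (c : C) (x : R) : continuousC (fun _ => c) x.
Proof. apply continuous_const. Qed.

Lemma continuousC_plus (f g : R -> C) (x : R) :
  continuousC f x -> continuousC g x -> continuousC (fun t => (f t + g t)%C) x.
Proof. apply (continuous_plus (V := C_R_NormedModule)). Qed.

Lemma continuousC_opp (f : R -> C) (x : R) :
  continuousC f x -> continuousC (fun t => (- f t)%C) x.
Proof. apply (continuous_opp (V := C_R_NormedModule)). Qed.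

Lemma continuousC_mult (f g : R -> C) (x : R) :
  continuousC f x -> continuousC g x -> continuousC (fun t => (f t * g t)%C) x.
Proof.
rewrite !continuousC_pair; intros [H1 H2] [H3 H4]; split; simpl.
- apply (continuous_minus (V := R_NormedModule)); now apply (continuous_mult (K := R_AbsRing)).
- apply (continuous_plus (V := R_NormedModule)); now apply (continuous_mult (K := R_AbsRing)).
Qed.

Lemma continuousC_inv (f : R -> C) (x : R) :
  f x <> 0%C -> continuousC f x -> continuousC (fun t => (/ f t)%C) x.
Proof.
intros Hf; rewrite !continuousC_pair; intros [H1 H2].
assert (Hd : continuous (fun t => / (Re (f t) ^ 2 + Im (f t) ^ 2)) x).
{ apply (continuous_comp (fun t => Re (f t) ^ 2 + Im (f t) ^ 2) Rinv).
  - apply (continuous_plus (V := R_NormedModule)).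
    + apply (continuous_comp (fun t => Re (f t)) (fun y => y ^ 2)); trivial.
      apply (ex_derive_continuous (V := R_NormedModule)); auto_derive; trivial.
    + apply (continuous_comp (fun t => Im (f t)) (fun y => y ^ 2)); trivial.
      apply (ex_derive_continuous (V := R_NormedModule)); auto_derive; trivial.
  - apply continuous_Rinv; rewrite <- Cmod2_alt.
    apply pow_nonzero, Rgt_not_eq, Cmod_gt_0; trivial. }
split; simpl.
- now apply (continuous_mult (K := R_AbsRing)).
- apply (continuous_mult (K := R_AbsRing)); trivial.
  now apply (continuous_opp (V := R_NormedModule)).
Qed.

Lemma continuousC_Cexp (f : R -> C) (x : R) :
  continuousC f x -> continuousC (fun t => Cexp (f t)) x.
Proof.
rewrite !continuousC_pair; intros [H1 H2]; split; simpl;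
  apply (continuous_mult (K := R_AbsRing)).
- apply (continuous_comp (fun t => Re (f t)) exp); trivial; apply continuous_exp.
- apply (continuous_comp (fun t => Im (f t)) cos); trivial; apply continuous_cos.
- apply (continuous_comp (fun t => Re (f t)) exp); trivial; apply continuous_exp.
- apply (continuous_comp (fun t => Im (f t)) sin); trivial; apply continuous_sin.
Qed.

Lemma continuousC_RtoC (x : R) : continuousC RtoC x.
Proof.
apply continuousC_pair; split; simpl; [apply continuous_id | apply continuous_const].
Qed.

Lemma continuousC_Cpower_RtoC (s : C) (x : R) :
  0 < x -> continuousC (fun t => Cpower (RtoC t) s) x.
Proof.
intros Hx; unfold Cpower; apply continuousC_Cexp, continuousC_mult; [apply continuousC_const |].
apply (continuous_ext_loc (U := C_R_NormedModule) _ (fun t => RtoC (ln t))).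
- exists (mkposreal x Hx); intros y Hy; simpl in Hy.
  rewrite Clog_RtoC; trivial.
  unfold ball in Hy; simpl in Hy; unfold AbsRing_ball, minus, plus, opp, abs in Hy; simpl in Hy.
  apply Rabs_lt_between in Hy; lra.
- apply (continuous_comp (W := C_R_NormedModule) ln RtoC); [now apply continuous_ln |].
  apply continuousC_RtoC.
Qed.

(** * Powers against exponentials, and an integrable weight *)

Lemma exp_nondecreasing (x y : R) : x <= y -> exp x <= exp y.
Proof. intros [H| ->]; [left; now apply exp_increasing | lra]. Qed.

(** After taking logarithms this is [1 + ln y <= y] at [y = c x], multiplied by [k]. The choice of
    [c] gives [k c + c = d], which also covers [k = 0]. *)
Lemma Rpower_exp_bound (k d : R) : 0 <= k -> 0 < d ->
  exists M, 0 < M /\ forall x, 0 < x -> Rpower x k <= M * exp (d * x).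
Proof.
intros Hk Hd; set (c := d / (k + 1)).
assert (Hc : 0 < c) by (apply Rdiv_lt_0_compat; lra).
exists (exp (k * (- 1 - ln c))); split; [apply exp_pos |].
intros x Hx; unfold Rpower; rewrite <- exp_plus; apply exp_nondecreasing.
assert (H := exp_ineq1_le (ln (c * x))).
rewrite exp_ln, ln_mult in H by (trivial; nra).
assert (E : k * c = d - c) by (unfold c; field; lra).
replace (d * x) with (k * (c * x) + c * x) by nra.
assert (0 < c * x) by nra.
assert (k * ln x <= k * (c * x - 1 - ln c)) by (apply Rmult_le_compat_l; lra).
lra.
Qed.

Lemma Rpower_pos (x k : R) : 0 < Rpower x k.
Proof. apply exp_pos. Qed.

(* Derivative of the bounded increasing function [- / (e (1 + x ^ e))]. *)
Definition weight (e x : R) : R := Rpower x (e - 1) / (1 + Rpower x e) ^ 2.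

(** Clearing the denominator and expanding [(1 + x^e)^2] leaves the powers [k], [k + e] and
    [k + 2e], each bounded by a multiple of [e^(d x)]; hence the binomial coefficients in the
    constant. *)
Lemma Rpower_exp_weight (k e d : R) : 0 <= k -> 0 < e -> 0 < d ->
  exists M, 0 < M /\ forall x, 0 < x ->
    Rpower x (k + (e - 1)) * exp (- (d * x)) <= M * weight e x.
Proof.
intros Hk He Hd.
destruct (Rpower_exp_bound k d Hk Hd) as [M0 [HM0 H0]].
destruct (Rpower_exp_bound (k + e) d ltac:(lra) Hd) as [M1 [HM1 H1]].
destruct (Rpower_exp_bound (k + e + e) d ltac:(lra) Hd) as [M2 [HM2 H2]].
exists (M0 + 2 * M1 + M2); split; [lra |].
intros x Hx; specialize (H0 x Hx); specialize (H1 x Hx); specialize (H2 x Hx).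
unfold weight; rewrite !Rpower_plus in *; rewrite exp_Ropp.
pose proof (Rpower_pos x k); pose proof (Rpower_pos x e); pose proof (Rpower_pos x (-1)).
pose proof (exp_pos (d * x)).
set (E := exp (d * x)) in *; set (X := Rpower x e) in *; set (Y := Rpower x (- (1))) in *.
set (P := Rpower x k) in *.
unfold Rminus; rewrite Rpower_plus; fold X Y.
assert (H7 : P * (1 + X) ^ 2 <= (M0 + 2 * M1 + M2) * E) by nra.
replace (P * (X * Y) * / E) with (X * Y / (E * (1 + X) ^ 2) * (P * (1 + X) ^ 2))
  by (field; lra).
replace ((M0 + 2 * M1 + M2) * (X * Y / (1 + X) ^ 2))
  with (X * Y / (E * (1 + X) ^ 2) * ((M0 + 2 * M1 + M2) * E)) by (field; lra).
apply Rmult_le_compat_l; trivial.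
assert (0 < X * Y) by (apply Rmult_lt_0_compat; trivial).
apply Rlt_le, Rdiv_lt_0_compat; trivial.
apply Rmult_lt_0_compat; trivial; apply pow_lt; lra.
Qed.

Lemma continuous_Rpower (k x : R) : 0 < x -> continuous (fun t => Rpower t k) x.
Proof.
intros Hx; apply (ex_derive_continuous (V := R_NormedModule)).
eexists; apply is_derive_Reals, (derivable_pt_lim_power x k Hx).
Qed.

Lemma is_derive_weight (e x : R) : 0 < e -> 0 < x ->
  is_derive (fun t => - / (e * (1 + Rpower t e))) x (weight e x).
Proof.
intros He Hx; pose proof (Rpower_pos x e).
assert (H1 : is_derive (fun t => Rpower t e) x (e * Rpower x (e - 1)))
  by apply is_derive_Reals, (derivable_pt_lim_power x e Hx).
apply (is_derive_ext (fun t => (fun y => - / (e * (1 + y))) (Rpower t e))); [easy |].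
replace (weight e x) with (scal (e * Rpower x (e - 1)) (/ (e * (1 + Rpower x e) ^ 2))).
- apply (is_derive_comp (fun y => - / (e * (1 + y))) (fun t => Rpower t e)); trivial.
  auto_derive; [nra | field; lra].
- unfold weight, scal; simpl; unfold mult; simpl; field; lra.
Qed.

Lemma continuous_weight (e x : R) : 0 < x -> continuous (weight e) x.
Proof.
intros Hx; unfold weight; apply (continuous_mult (K := R_AbsRing)).
- now apply continuous_Rpower.
- pose proof (Rpower_pos x e).
  apply (continuous_comp (fun t => Rpower t e) (fun y => / (1 + y) ^ 2)).
  + now apply continuous_Rpower.
  + apply (ex_derive_continuous (V := R_NormedModule)); auto_derive; nra.
Qed.

(** The antiderivative rises from [- / e] at [0] to [0] at infinity, so [weight e] has total mass
    [/ e]. *)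
Lemma is_RInt_gen_weight (f : R -> C) (e K : R) : 0 < e ->
  (forall x, 0 < x -> continuousC f x) ->
  (forall x, 0 < x -> Cmod (f x) <= K * weight e x) ->
  exists l : C, is_RInt_gen (V := C_R_NormedModule) f (at_right 0) (Rbar_locally p_infty) l /\
    Cmod l <= K / e.
Proof.
intros He Hf HK.
set (G := fun t => - / (e * (1 + Rpower t e))).
destruct (is_RInt_gen_dominated (V := C_R_CompleteNormedModule) f
  (fun x => K * weight e x) (fun x => K * G x) (K * - / e) (K * 0)) as [l [Hl Hb]]; trivial.
- intros x Hx; apply (continuous_mult (K := R_AbsRing)); [apply continuous_const |].
  now apply continuous_weight.
- intros x Hx; apply (is_derive_scal G); now apply is_derive_weight.
- intros x Hx; rewrite <- Cmod_norm; auto.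
- apply (filterlim_comp _ _ _ G (Rmult K) _ (locally (- / e))).
  + apply filterlim_locally; intros eps.
    (* Below this threshold [x^e < eps * e], and the distance from [G x] to [- / e] is
       [x^e / (e (1 + x^e))]. *)
    assert (Hd : 0 < Rpower (eps * e) (/ e)) by apply Rpower_pos.
    generalize (at_right_0_lt _ Hd); apply filter_imp; intros x Hx.
    unfold ball; simpl; unfold AbsRing_ball, minus, plus, opp, abs; simpl.
    assert (Hp : Rpower x e < eps * e).
    { rewrite <- (Rpower_1 (eps * e)), <- (Rinv_l e), <- Rpower_mult
        by (try apply Rmult_lt_0_compat; try apply cond_pos; lra).
      apply Rlt_Rpower_l; lra. }
    pose proof (Rpower_pos x e); unfold G; apply Rabs_lt_between.
    replace (- / (e * (1 + Rpower x e)) + - - / e)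
      with (/ e * (Rpower x e / (1 + Rpower x e))) by (field; lra).
    assert (Rpower x e / (1 + Rpower x e) < eps * e).
    { apply Rmult_lt_reg_r with (1 + Rpower x e); [lra |].
      unfold Rdiv; rewrite Rmult_assoc, Rinv_l by lra; nra. }
    assert (0 < Rpower x e / (1 + Rpower x e)) by (apply Rdiv_lt_0_compat; lra).
    assert (0 < / e) by (apply Rinv_0_lt_compat; lra).
    assert (/ e * (Rpower x e / (1 + Rpower x e)) < / e * (eps * e))
      by (apply Rmult_lt_compat_l; lra).
    replace (/ e * (eps * e)) with (pos eps) in * by (field; lra).
    pose proof (cond_pos eps); nra.
  + apply (continuous_scal_r (V := R_NormedModule) K (fun t => t)), continuous_id.
- apply (filterlim_comp _ _ _ G (Rmult K) _ (locally 0)).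
  + apply filterlim_locally; intros eps.
    generalize (Rbar_locally_p_infty_lt (Rpower (/ (eps * e)) (/ e))).
    apply filter_imp; intros x Hx.
    unfold ball; simpl; unfold AbsRing_ball, minus, plus, opp, abs; simpl.
    pose proof (cond_pos eps).
    assert (0 < eps * e) by (apply Rmult_lt_0_compat; lra).
    assert (Hp : / (eps * e) < Rpower x e).
    { rewrite <- (Rpower_1 (/ (eps * e))), <- (Rinv_l e), <- Rpower_mult
        by (try apply Rinv_0_lt_compat; lra).
      apply Rlt_Rpower_l; trivial; split; [apply Rpower_pos | lra]. }
    assert (0 < / (eps * e)) by (now apply Rinv_0_lt_compat).
    unfold G; rewrite Ropp_0, Rplus_0_r, Rabs_Ropp, Rabs_inv, Rabs_pos_eq by nra.
    rewrite <- (Rinv_inv eps); apply Rinv_lt_contravar.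
    * apply Rmult_lt_0_compat; [now apply Rinv_0_lt_compat | nra].
    * replace (/ eps) with (e * / (eps * e)) by (field; lra).
      apply Rmult_lt_compat_l; lra.
  + apply (continuous_scal_r (V := R_NormedModule) K (fun t => t)), continuous_id.
- exists l; split; trivial.
  rewrite <- Cmod_norm in Hb; unfold Rdiv; lra.
Qed.

(** * Rotation of the path of integration *)

Section Rotation.

Variables p zeta : C.

(* With [H(s,t) = exp (p (ln t + s zeta) - t e^(s zeta))], [rot_re] and [rot_im] are the
   real and imaginary parts of the exponent, and [rot c d s t] is
   [(c Re H + d Im H) / t].  The function [H] depends on [ln t + s zeta] only, so
   [d/ds H = zeta t d/dt H]; hence [d/ds (rot c d s t) = d/dt (rot_prim c d s t)]. *)
Definition rot_re (s t : R) : R :=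
  Re p * (ln t + s * Re zeta) - Im p * (s * Im zeta) - t * (exp (s * Re zeta) * cos (s * Im zeta)).

Definition rot_im (s t : R) : R :=
  Im p * (ln t + s * Re zeta) + Re p * (s * Im zeta) - t * (exp (s * Re zeta) * sin (s * Im zeta)).

Definition rot (c d s t : R) : R :=
  exp (rot_re s t) * (c * cos (rot_im s t) + d * sin (rot_im s t)) / t.

Definition rot_prim (c d s t : R) : R :=
  exp (rot_re s t) *
  (Re zeta * (c * cos (rot_im s t) + d * sin (rot_im s t)) -
   Im zeta * (c * sin (rot_im s t) - d * cos (rot_im s t))).

(** This is [c Re + d Im] of [(p / t - e^(s zeta)) zeta H], the common value of the [s]-derivative
    of [rot] and the [t]-derivative of [rot_prim]. *)
Definition rot_deriv (c d s t : R) : R :=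
  exp (rot_re s t) *
  ((Re p * / t - exp (s * Re zeta) * cos (s * Im zeta)) *
     (Re zeta * (c * cos (rot_im s t) + d * sin (rot_im s t)) -
      Im zeta * (c * sin (rot_im s t) - d * cos (rot_im s t))) -
   (Im p * / t - exp (s * Re zeta) * sin (s * Im zeta)) *
     (Re zeta * (c * sin (rot_im s t) - d * cos (rot_im s t)) +
      Im zeta * (c * cos (rot_im s t) + d * sin (rot_im s t)))).

Lemma is_derive_rot (c d s t : R) : 0 < t ->
  is_derive (fun s => rot c d s t) s (rot_deriv c d s t).
Proof.
intros Ht; unfold rot, rot_deriv, rot_re, rot_im; unfold Rminus; auto_derive; [lra |]; field; lra.
Qed.

Lemma is_derive_rot_prim (c d s t : R) : 0 < t ->
  is_derive (fun t => rot_prim c d s t) t (rot_deriv c d s t).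
Proof.
intros Ht; unfold rot_prim, rot_deriv, rot_re, rot_im; unfold Rminus; auto_derive; [lra |]; field; lra.
Qed.

Lemma continuity_2d_pt_rot_deriv (c d s t : R) : 0 < t -> continuity_2d_pt (rot_deriv c d) s t.
Proof.
intros Ht; unfold rot_deriv, rot_re, rot_im.
repeat first
  [ apply continuity_2d_pt_plus | apply continuity_2d_pt_opp | apply continuity_2d_pt_mult
  | apply continuity_2d_pt_const | apply continuity_2d_pt_id1 | apply continuity_2d_pt_id2
  | apply (continuity_1d_2d_pt_comp ln); [now apply continuity_pt_filterlim, continuous_ln |]
  | apply (continuity_1d_2d_pt_comp exp); [apply derivable_continuous_pt, derivable_pt_exp |]
  | apply (continuity_1d_2d_pt_comp cos); [apply continuity_cos |]
  | apply (continuity_1d_2d_pt_comp sin); [apply continuity_sin |]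
  | apply continuity_2d_pt_inv; [| lra] ].
Qed.

Lemma ex_RInt_rot (c d s u v : R) : 0 < u -> 0 < v -> ex_RInt (rot c d s) u v.
Proof.
intros Hu Hv; apply (ex_RInt_continuous_half_line (V := R_CompleteNormedModule)); trivial.
intros x Hx.
apply (ex_derive_continuous (V := R_NormedModule)).
unfold rot, rot_re, rot_im; auto_derive; lra.
Qed.

(** Differentiation under the integral sign, legitimate on the compact [[u, v]], turns the integrand
    into the [t]-derivative of [rot_prim]; only the endpoints survive. *)
Lemma is_derive_RInt_rot (c d s u v : R) : 0 < u < v ->
  is_derive (fun s => RInt (rot c d s) u v) s (rot_prim c d s v - rot_prim c d s u).
Proof.
intros Huv.
assert (Hmm : forall t, Rmin u v <= t <= Rmax u v -> 0 < t)
  by (intros t; rewrite Rmin_left by lra; lra).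
assert (HI : is_RInt (rot_deriv c d s) u v (rot_prim c d s v - rot_prim c d s u)).
{ apply (is_RInt_derive (rot_prim c d s) (rot_deriv c d s)); intros t Ht; apply Hmm in Ht.
  - now apply is_derive_rot_prim.
  - apply (ex_derive_continuous (V := R_NormedModule)).
    unfold rot_deriv, rot_re, rot_im; auto_derive; lra. }
rewrite <- (is_RInt_unique _ _ _ _ HI).
rewrite (RInt_ext _ (fun t => Derive (fun s => rot c d s t) s)).
2:{ intros t Ht; symmetry; apply is_derive_unique, is_derive_rot, Hmm; lra. }
apply (is_derive_RInt_param (rot c d)).
- apply filter_forall; intros y t Ht; apply Hmm in Ht.
  eexists; now apply is_derive_rot.
- intros t Ht; apply Hmm in Ht.
  apply (continuity_2d_pt_ext_loc (rot_deriv c d)).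
  + exists (mkposreal t Ht); simpl; intros a b _ Hb; symmetry.
    apply is_derive_unique, is_derive_rot; apply Rabs_lt_between in Hb; lra.
  + now apply continuity_2d_pt_rot_deriv.
- apply filter_forall; intros y; apply ex_RInt_rot; lra.
Qed.

(* [Re (e^(s zeta)) >= delta > 0] uniformly for [0 <= s <= 1]. *)
Lemma rot_prim_bound (c d : R) : 1 < Re p -> Rabs (Im zeta) < PI / 2 ->
  exists K, forall s t, 0 <= s <= 1 -> 0 < t ->
    Rabs (rot_prim c d s t) <= K * t /\ Rabs (rot_prim c d s t) <= K * / t.
Proof.
intros Hp Hz.
set (delta := exp (- Rabs (Re zeta)) * cos (Im zeta)).
assert (Hcos : 0 < cos (Im zeta)) by (apply Rabs_lt_between in Hz; apply cos_gt_0; lra).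
assert (Hdelta : 0 < delta) by (apply Rmult_lt_0_compat; [apply exp_pos | trivial]).
(* The factorizations [t^(Re p) = t * t^(Re p - 1) = / t * t^(Re p + 1)] give the bound by [K * t],
   useful near [0], and the bound by [K * / t], useful near infinity. *)
destruct (Rpower_exp_bound (Re p - 1) delta ltac:(lra) Hdelta) as [M1 [HM1 H1]].
destruct (Rpower_exp_bound (Re p + 1) delta ltac:(lra) Hdelta) as [M2 [HM2 H2]].
set (C0 := exp (Rabs (Re p * Re zeta) + Rabs (Im p * Im zeta)) *
  ((Rabs (Re zeta) + Rabs (Im zeta)) * (Rabs c + Rabs d))).
assert (HC0 : 0 <= C0).
{ apply Rmult_le_pos; [left; apply exp_pos |].
  apply Rmult_le_pos; apply Rplus_le_le_0_compat; apply Rabs_pos. }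
assert (Hb : forall s t, 0 <= s <= 1 -> 0 < t ->
   Rabs (rot_prim c d s t) <= C0 * (Rpower t (Re p) * / exp (delta * t))).
{ intros s t Hs Ht; unfold rot_prim.
  rewrite Rabs_mult, (Rabs_pos_eq (exp _)) by (left; apply exp_pos).
  replace (C0 * (Rpower t (Re p) * / exp (delta * t)))
   with (exp (Rabs (Re p * Re zeta) + Rabs (Im p * Im zeta)) *
         (Rpower t (Re p) * / exp (delta * t)) *
         ((Rabs (Re zeta) + Rabs (Im zeta)) * (Rabs c + Rabs d))) by (unfold C0; ring).
  apply Rmult_le_compat; [left; apply exp_pos | apply Rabs_pos | |].
  - unfold Rpower; rewrite <- exp_Ropp, <- !exp_plus; apply exp_nondecreasing.
    unfold rot_re.
    assert (Habs : forall a, s * a <= Rabs a).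
    { intros a; apply Rle_trans with (s * Rabs a);
        [apply Rmult_le_compat_l; [lra | apply Rle_abs] | pose proof (Rabs_pos a); nra]. }
    pose proof (Habs (Re p * Re zeta)); pose proof (Habs (- (Im p * Im zeta))).
    rewrite Rabs_Ropp in *.
    assert (He : exp (- Rabs (Re zeta)) <= exp (s * Re zeta)).
    { apply exp_nondecreasing; pose proof (Habs (- Re zeta)); rewrite Rabs_Ropp in *; lra. }
    (* Cosine is even and decreasing on [[0, PI]], and [s |Im zeta| <= |Im zeta|]. *)
    assert (Hc : cos (Im zeta) <= cos (s * Im zeta)).
    { assert (E : forall a, cos a = cos (Rabs a))
        by (intros a; unfold Rabs; destruct (Rcase_abs a); rewrite ?cos_neg; trivial).
      rewrite (E (Im zeta)), (E (s * Im zeta)).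
      rewrite Rabs_mult, (Rabs_pos_eq s) by lra.
      pose proof (Rabs_pos (Im zeta)); apply cos_decr_1; nra. }
    assert (delta <= exp (s * Re zeta) * cos (s * Im zeta)).
    { apply Rmult_le_compat; trivial; [left; apply exp_pos | lra]. }
    assert (t * delta <= t * (exp (s * Re zeta) * cos (s * Im zeta)))
      by (apply Rmult_le_compat_l; lra).
    lra.
  - assert (Hcs : forall a b x y, Rabs x <= 1 -> Rabs y <= 1 ->
       Rabs (a * x + b * y) <= Rabs a + Rabs b).
    { intros a b x y Hx Hy; eapply Rle_trans; [apply Rabs_triang |].
      rewrite !Rabs_mult; pose proof (Rabs_pos a); pose proof (Rabs_pos b); nra. }
    assert (Hcos1 : Rabs (cos (rot_im s t)) <= 1)
      by (apply Rabs_le; pose proof (COS_bound (rot_im s t)); lra).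
    assert (Hsin1 : Rabs (sin (rot_im s t)) <= 1)
      by (apply Rabs_le; pose proof (SIN_bound (rot_im s t)); lra).
    pose proof (Hcs c d _ _ Hcos1 Hsin1) as Ha1.
    pose proof (Hcs c (- d) _ _ Hsin1 Hcos1) as Ha2.
    rewrite Rabs_Ropp in Ha2.
    replace (c * sin (rot_im s t) - d * cos (rot_im s t))
      with (c * sin (rot_im s t) + - d * cos (rot_im s t)) by ring.
    unfold Rminus; eapply Rle_trans; [apply Rabs_triang |].
    rewrite Rabs_Ropp, !Rabs_mult.
    pose proof (Rabs_pos (Re zeta)); pose proof (Rabs_pos (Im zeta)); nra. }
exists (C0 * (M1 + M2)); intros s t Hs Ht.
specialize (Hb s t Hs Ht); specialize (H1 t Ht); specialize (H2 t Ht).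
pose proof (exp_pos (delta * t)) as He.
assert (0 < / t) by (now apply Rinv_0_lt_compat).
assert (E1 : Rpower t (Re p) = t * Rpower t (Re p - 1)).
{ rewrite <- (Rpower_1 t) at 2 by trivial; rewrite <- Rpower_plus; f_equal; ring. }
assert (E2 : Rpower t (Re p) = / t * Rpower t (Re p + 1)).
{ rewrite Rpower_plus, Rpower_1 by trivial; field; lra. }
split; (eapply Rle_trans; [apply Hb |]); rewrite Rmult_assoc; apply Rmult_le_compat_l; trivial;
  apply Rmult_le_reg_r with (exp (delta * t)); trivial; rewrite Rmult_assoc, Rinv_l by lra.
- assert (0 < t * (M2 * exp (delta * t))) by (repeat apply Rmult_lt_0_compat; trivial).
  rewrite E1; apply Rmult_le_compat_l with (r := t) in H1; lra.
- assert (0 < / t * (M1 * exp (delta * t))) by (repeat apply Rmult_lt_0_compat; trivial).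
  rewrite E2; apply Rmult_le_compat_l with (r := / t) in H2; lra.
Qed.

(** Mean value theorem in [s] on [[0, 1]]: the derivative is a difference of boundary terms, at most
    [K * u] at [u] and [K * / v] at [v]. *)
Lemma RInt_rot_close (c d : R) : 1 < Re p -> Rabs (Im zeta) < PI / 2 ->
  exists K, forall u v, 0 < u < v ->
    Rabs (RInt (rot c d 0) u v - RInt (rot c d 1) u v) <= K * (u + / v).
Proof.
intros Hp Hz; destruct (rot_prim_bound c d Hp Hz) as [K HK].
exists K; intros u v Huv.
destruct (MVT_gen (fun s => RInt (rot c d s) u v) 0 1
  (fun s => rot_prim c d s v - rot_prim c d s u)) as [s [Hs E]].
- intros s _; now apply is_derive_RInt_rot.
- intros s _; apply continuity_pt_filterlim.
  apply (ex_derive_continuous (V := R_NormedModule) (fun s => RInt (rot c d s) u v)).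
  eexists; exact (is_derive_RInt_rot c d s u v Huv).
- rewrite Rmin_left, Rmax_right in Hs by lra.
  rewrite Rabs_minus_sym, E, Rminus_0_r, Rmult_1_r.
  eapply Rle_trans; [apply Rabs_triang |]; rewrite Rabs_Ropp.
  destruct (HK s u Hs ltac:(lra)) as [H1 _]; destruct (HK s v Hs ltac:(lra)) as [_ H2].
  lra.
Qed.

(** Both sides are [H(s,t) / t]; the coefficient pairs [(1, 0)] and [(0, 1)] select its real and
    imaginary parts. *)
Lemma rot_C (s t : R) : 0 < t ->
  (Cpower (RtoC t) (p - 1) * Cexp (- (Cexp (s * zeta) * RtoC t)) * Cexp (p * (s * zeta)))%C =
  (rot 1 0 s t, rot 0 1 s t).
Proof.
intros Ht; unfold Cpower; rewrite Clog_RtoC by trivial.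
replace ((p - 1) * ln t)%C with (p * ln t - ln t)%C by ring.
unfold Cminus; rewrite Cexp_plus, Cexp_opp.
replace (Cexp (ln t)) with (RtoC t).
2:{ rewrite <- Clog_RtoC, Cexp_Clog; trivial; intros E; injection E; lra. }
replace (Cexp (p * ln t) * / t * Cexp (- (Cexp (s * zeta) * t)) * Cexp (p * (s * zeta)))%C
  with (Cexp (p * ln t + - (Cexp (s * zeta) * t) + p * (s * zeta)) * RtoC (/ t))%C.
2:{ rewrite !Cexp_plus, RtoC_inv by lra; ring. }
set (E := (_ + _ + _)%C).
assert (E0 : (s * zeta)%C = (s * Re zeta, s * Im zeta)).
{ unfold Cmult; simpl; f_equal; unfold Re, Im; ring. }
assert (E1 : Re E = rot_re s t).
{ unfold E; rewrite E0; unfold rot_re; simpl; unfold Re, Im; ring. }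
assert (E2 : Im E = rot_im s t).
{ unfold E; rewrite E0; unfold rot_im; simpl; unfold Re, Im; ring. }
unfold rot; rewrite <- E1, <- E2; unfold Cexp, Cmult, Rdiv; simpl; f_equal; ring.
Qed.

End Rotation.

(** * Euler integral on a ray *)

Notation is_RInt_genC f l :=
  (is_RInt_gen (V := C_R_NormedModule) f (at_right 0) (Rbar_locally p_infty) l).

Lemma is_RInt_genC_ext (f g : R -> C) (l : C) :
  (forall x, 0 < x -> f x = g x) -> is_RInt_genC f l -> is_RInt_genC g l.
Proof.
intros Hfg; apply (is_RInt_gen_ext (V := C_R_NormedModule)).
generalize (filter_prod_half_line 1 1 Rlt_0_1); apply filter_imp.
intros [u v]; simpl; intros Huv x; rewrite Rmin_left by lra; intros Hx; apply Hfg; lra.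
Qed.

Lemma is_RInt_genC_unique (f : R -> C) (l l' : C) :
  is_RInt_genC f l -> is_RInt_genC f l' -> l = l'.
Proof.
intros H H'; apply (is_RInt_gen_unique (V := C_R_CompleteNormedModule)) in H, H'.
now rewrite <- H.
Qed.

(** Integration takes place in a real normed module, where a complex factor is not a scalar; hence
    the passage through components. *)
Lemma is_RInt_Cmult_l (c : C) (f : R -> C) (u v : R) (l : C) :
  is_RInt (V := C_R_NormedModule) f u v l ->
  is_RInt (V := C_R_NormedModule) (fun t => (c * f t)%C) u v (c * l)%C.
Proof.
intros H.
pose proof (is_RInt_fct_extend_fst (U := R_NormedModule) (V := R_NormedModule) _ _ _ _ H) as H1.
pose proof (is_RInt_fct_extend_snd (U := R_NormedModule) (V := R_NormedModule) _ _ _ _ H) as H2.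
apply (is_RInt_fct_extend_pair (U := R_NormedModule) (V := R_NormedModule)); simpl.
- apply (is_RInt_minus (V := R_NormedModule)); now apply (is_RInt_scal (V := R_NormedModule)).
- apply (is_RInt_plus (V := R_NormedModule)); now apply (is_RInt_scal (V := R_NormedModule)).
Qed.

Lemma is_RInt_gen_Cmult_l (c : C) (f : R -> C) (l : C) :
  is_RInt_genC f l -> is_RInt_genC (fun t => (c * f t)%C) (c * l)%C.
Proof.
intros H P HP.
assert (HP' : locally (T := C_R_NormedModule) l (fun y => P (c * y)%C)).
{ exact (filterlim_scal_r (V := C_NormedModule) c l P HP). }
specialize (H _ HP'); unfold filtermapi in *; revert H; apply filter_imp.
intros ab [y [Hy HPy]]; exists (c * y)%C; split; trivial.
now apply is_RInt_Cmult_l.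
Qed.

Lemma RInt_C_pair (f : R -> C) (u v : R) :
  (forall x, 0 < x -> continuousC f x) -> 0 < u -> 0 < v ->
  RInt (V := C_R_CompleteNormedModule) f u v =
  (RInt (fun t => Re (f t)) u v, RInt (fun t => Im (f t)) u v).
Proof.
intros Hf Hu Hv; apply is_RInt_unique.
apply (is_RInt_fct_extend_pair (U := R_NormedModule) (V := R_NormedModule));
  apply (RInt_correct (V := R_CompleteNormedModule));
  apply (ex_RInt_continuous_half_line (V := R_CompleteNormedModule)); trivial;
  intros x Hx; now apply (continuousC_pair f x), Hf.
Qed.

Lemma Cmod_le_Rabs_plus (z : C) : Cmod z <= Rabs (Re z) + Rabs (Im z).
Proof.
pose proof (Rabs_pos (Re z)); pose proof (Rabs_pos (Im z)).
apply Rsqr_incr_0; [| apply Cmod_ge_0 | lra].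
rewrite !Rsqr_pow2, Cmod2_alt, <- (pow2_abs (Re z)), <- (pow2_abs (Im z)); nra.
Qed.

Lemma continuousC_Gamma_integrand (p w : C) (x : R) : 0 < x ->
  continuousC (fun t => (Cpower (RtoC t) (p - 1) * Cexp (- (w * RtoC t)))%C) x.
Proof.
intros Hx; apply continuousC_mult; [now apply continuousC_Cpower_RtoC |].
apply continuousC_Cexp, continuousC_opp, continuousC_mult.
- apply continuousC_const.
- apply continuousC_RtoC.
Qed.

Lemma Cmod_Gamma_integrand (p w : C) (x : R) : 0 < x ->
  Cmod (Cpower (RtoC x) (p - 1) * Cexp (- (w * RtoC x))) =
  Rpower x (Re p - 1) * exp (- (Re w * x)).
Proof.
intros Hx; rewrite Cmod_mult, Cmod_Cpower_RtoC, Cmod_Cexp by trivial.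
f_equal; f_equal; simpl; unfold Re; ring.
Qed.

(** Convergence of Euler's integral comes from the weight with [e = 1], that is, from
    [M / (1 + t)^2]. *)
Lemma is_RInt_gen_CGamma (p : C) : 1 < Re p ->
  is_RInt_genC (fun t => (Cpower (RtoC t) (p - 1) * Cexp (- RtoC t))%C) (CGamma p).
Proof.
intros Hp.
apply (RInt_gen_correct (V := C_R_CompleteNormedModule)).
destruct (Rpower_exp_weight (Re p - 1) 1 1 ltac:(lra) Rlt_0_1 Rlt_0_1) as [M [_ HM]].
assert (E : forall t : R, (- RtoC t = - (1 * RtoC t))%C) by (intros; ring).
destruct (is_RInt_gen_weight
  (fun t => (Cpower (RtoC t) (p - 1) * Cexp (- RtoC t))%C) 1 M) as [l [Hl _]].
- lra.
- intros x Hx; apply (continuous_ext (U := C_R_NormedModule)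
    (fun t => (Cpower (RtoC t) (p - 1) * Cexp (- (1 * RtoC t)))%C)).
  + now intros t; rewrite <- E.
  + now apply continuousC_Gamma_integrand.
- intros x Hx; rewrite E, Cmod_Gamma_integrand by trivial.
  eapply Rle_trans; [| apply HM]; trivial.
  apply Req_le; simpl; f_equal; f_equal; ring.
- now exists l.
Qed.

(* The integrand [w^p t^(p-1) e^(-wt)] along [w = e^(s zeta)], [zeta = Clog w],
   has an integral whose [s]-derivative is a boundary term, so the improper
   integral is the same at [s = 1] as at [s = 0]. *)
Lemma is_RInt_gen_CGamma_scaled (p w : C) : 1 < Re p -> 0 < Re w ->
  is_RInt_genC (fun t => (Cpower (RtoC t) (p - 1) * Cexp (- (w * RtoC t)))%C)
    (CGamma p / Cpower w p)%C.
Proof.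
intros Hp Hw.
assert (Hw0 : w <> 0%C) by (intros ->; simpl in Hw; lra).
set (h := fun t : R => (Cpower w p * (Cpower (RtoC t) (p - 1) * Cexp (- (w * RtoC t))))%C).
set (f := fun t : R => (Cpower (RtoC t) (p - 1) * Cexp (- RtoC t))%C).
assert (Ef : forall t, 0 < t -> f t = (rot p (Clog w) 1 0 0 t, rot p (Clog w) 0 1 0 t)).
{ intros t Ht; rewrite <- rot_C by trivial; unfold f.
  replace (RtoC 0 * Clog w)%C with (RtoC 0) by ring.
  replace (p * 0)%C with (RtoC 0) by ring.
  rewrite Cexp_0; ring_simplify; f_equal; f_equal; ring. }
assert (Eh : forall t, 0 < t -> h t = (rot p (Clog w) 1 0 1 t, rot p (Clog w) 0 1 1 t)).
{ intros t Ht; rewrite <- rot_C by trivial; unfold h.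
  replace (RtoC 1 * Clog w)%C with (Clog w) by ring.
  rewrite Cexp_Clog by trivial; unfold Cpower at 1; ring. }
assert (Hf : forall x, 0 < x -> continuousC f x).
{ intros x Hx; apply (continuous_ext (U := C_R_NormedModule)
    (fun t => (Cpower (RtoC t) (p - 1) * Cexp (- (1 * RtoC t)))%C)).
  - intros t; unfold f; now rewrite Cmult_1_l.
  - now apply continuousC_Gamma_integrand. }
assert (Hh : forall x, 0 < x -> continuousC h x).
{ intros x Hx; apply continuousC_mult; [apply continuousC_const |].
  now apply continuousC_Gamma_integrand. }
assert (Hc : is_RInt_genC h (CGamma p)).
(* The imaginary part of [Clog w] is the angle of rotation; below [PI / 2] the exponential decays
   along every intermediate ray. *)
{ pose proof (Carg_right_half_plane w Hw) as Ha.
  change (Carg w) with (Im (Clog w)) in Ha.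
  destruct (RInt_rot_close p (Clog w) 1 0 Hp Ha) as [K1 HK1].
  destruct (RInt_rot_close p (Clog w) 0 1 Hp Ha) as [K2 HK2].
  apply (is_RInt_gen_close (V := C_R_CompleteNormedModule) f h (K1 + K2)); trivial.
  2: now apply is_RInt_gen_CGamma.
  intros u v Huv.
  assert (E : forall g s, (forall x, 0 < x -> continuousC g x) ->
    (forall t, 0 < t -> g t = (rot p (Clog w) 1 0 s t, rot p (Clog w) 0 1 s t)) ->
    RInt (V := C_R_CompleteNormedModule) g u v =
    (RInt (rot p (Clog w) 1 0 s) u v, RInt (rot p (Clog w) 0 1 s) u v)).
  { intros g s Hg Eg; rewrite RInt_C_pair by (trivial; lra).
    f_equal; apply RInt_ext; intros x; rewrite Rmin_left by lra; intros Hx;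
      rewrite Eg by lra; trivial. }
  rewrite (E f 0), (E h 1) by trivial.
  rewrite <- Cmod_norm; eapply Rle_trans; [apply Cmod_le_Rabs_plus |].
  rewrite Rmult_plus_distr_r; apply Rplus_le_compat; [now apply HK1 | now apply HK2]. }
apply (is_RInt_gen_Cmult_l (/ Cpower w p)) in Hc.
unfold Cdiv; rewrite Cmult_comm; revert Hc.
apply is_RInt_genC_ext; intros x _; unfold h.
field; apply Cpower_neq_0.
Qed.

(** * Geometric expansion and the Hurwitz zeta function *)

(** The imaginary part of [s] contributes the factor [e^(- Im s * Carg z)], controlled by
    [|Carg z| <= PI]. *)
Lemma Cmod_Cpower_le (z s : C) :
  Cmod (Cpower z s) <= Rpower (Cmod z) (Re s) * exp (PI * Rabs (Im s)).
Proof.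
unfold Cpower, Rpower; rewrite Cmod_Cexp, <- exp_plus; apply exp_nondecreasing.
change (Re (s * Clog z)) with (Re s * ln (Cmod z) - Im s * Carg z).
pose proof (Carg_bound z) as H; pose proof (Rabs_pos (Im s)).
assert (Rabs (Im s * Carg z) <= PI * Rabs (Im s)).
{ rewrite Rabs_mult, Rmult_comm; now apply Rmult_le_compat_r. }
pose proof (Rle_abs (- (Im s * Carg z))); rewrite Rabs_Ropp in *.
lra.
Qed.

(** The mean value theorem for [x^(1 - s)] on [[n + 1, n + 2]] bounds each term by a multiple of
    [t n - t (S n)]; this telescopes, and [t] converges because it is positive and decreasing. *)
Lemma ex_series_Rpower (s : R) : 1 < s -> ex_series (fun n => Rpower (INR (S (S n))) (- s)).
Proof.
intros Hs; set (t := fun n => Rpower (INR (S n)) (1 - s)).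
assert (Ht : forall n, (s - 1) * Rpower (INR (S (S n))) (- s) <= t n - t (S n)).
{ intros n; unfold t; rewrite (S_INR (S n)).
  assert (H1 : 0 < INR (S n)) by apply lt_0_INR, Nat.lt_0_succ.
  destruct (MVT_cor2 (fun x => Rpower x (1 - s)) (fun x => (1 - s) * Rpower x (1 - s - 1))
    (INR (S n)) (INR (S n) + 1)) as [c [E Hc]]; [lra | |].
  - intros c Hc; apply derivable_pt_lim_power; lra.
  - replace (1 - s - 1) with (- s) in E by ring.
    assert (Rpower (INR (S n) + 1) (- s) <= Rpower c (- s)).
    { rewrite !Rpower_Ropp; apply Rinv_le_contravar; [apply Rpower_pos |].
      apply Rle_Rpower_l; lra. }
    nra. }
assert (Hdec : forall n, t (S n) <= t n).
{ intros n; specialize (Ht n); pose proof (Rpower_pos (INR (S (S n))) (- s)); nra. }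
destruct (ex_finite_lim_seq_decr t 0 Hdec) as [l Hl].
{ intros n; left; apply Rpower_pos. }
apply (ex_series_le (V := R_CompleteNormedModule) _
  (fun n => scal (/ (s - 1)) (t n - t (S n)))).
- intros n; unfold norm, scal; simpl; unfold abs, mult; simpl.
  rewrite Rabs_pos_eq by (left; apply Rpower_pos).
  apply Rmult_le_reg_l with (s - 1); [lra |].
  rewrite <- Rmult_assoc, Rinv_r, Rmult_1_l by lra; apply Ht.
- apply (ex_series_scal (V := R_NormedModule)).
  exists (t O - l).
  apply (is_lim_seq_ext (fun n => t O - t (S n)) _ (t O - l)).
  + intros n; induction n as [|n IH].
    * now rewrite sum_O.
    * rewrite sum_Sn, <- IH; unfold plus; simpl; ring.
  + apply is_lim_seq_minus'; [apply is_lim_seq_const |].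
    now apply is_lim_seq_incr_1 in Hl.
Qed.

Lemma ex_series_Hurwitz (s c : C) (k : R) : 1 < Re s -> 0 < k ->
  (forall n, k * INR n <= Cmod (RtoC (INR n) + c)) ->
  ex_series (V := C_R_NormedModule) (fun n => Cpower (RtoC (INR n) + c) (- s)).
Proof.
intros Hs Hk Hc.
(* Two terms are dropped to align with a comparison series starting at [2]; this also avoids
   [n = 0], where the lower bound [k * INR n] vanishes. *)
apply (ex_series_incr_n (V := C_R_NormedModule) _ 2).
apply (ex_series_le (V := C_R_CompleteNormedModule) _
  (fun n => scal (exp (PI * Rabs (Im s)) * Rpower k (- Re s))
              (Rpower (INR (S (S n))) (- Re s)))).
- intros n; rewrite <- Cmod_norm; change (2 + n)%nat with (S (S n)).
  specialize (Hc (S (S n))); eapply Rle_trans; [apply Cmod_Cpower_le |].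
  assert (Hn : 0 < INR (S (S n))) by apply lt_0_INR, Nat.lt_0_succ.
  replace (Re (- s)) with (- Re s) by now destruct s.
  replace (Im (- s)) with (- Im s) by now destruct s.
  rewrite Rabs_Ropp; unfold scal; simpl scal; unfold mult; simpl mult.
  rewrite Rmult_assoc, Rpower_mult_distr, Rmult_comm by trivial.
  apply Rmult_le_compat_l; [left; apply exp_pos |].
  rewrite !Rpower_Ropp; apply Rinv_le_contravar; [apply Rpower_pos |].
  apply Rle_Rpower_l; [lra |]; split; trivial; now apply Rmult_lt_0_compat.
- now apply (ex_series_scal (V := R_NormedModule)), ex_series_Rpower.
Qed.

(** [iota] asks for uniqueness as well as existence; uniqueness is that of limits. *)
Lemma is_series_Hurwitz_zeta (s c : C) :
  ex_series (V := C_R_NormedModule) (fun n => Cpower (RtoC (INR n) + c) (- s)) ->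
  is_series (V := C_R_NormedModule) (fun n => Cpower (RtoC (INR n) + c) (- s))
    (Hurwitz_zeta s c).
Proof.
intros [l Hl]; apply (iota_correct (V := C_R_CompleteNormedModule) (is_series (V := C_R_NormedModule) _)).
exists l; split; trivial; intros l' Hl'.
exact (filterlim_locally_unique (V := C_R_NormedModule) _ _ _ Hl Hl').
Qed.

(** [|1 - e^(-z)| >= 1 - e^(-Re z) >= 1 - 1 / (1 + Re z)], and the last quantity is the inverse of
    [1 + 1 / Re z]. *)
Lemma Cmod_inv_1_minus_Cexp (z : C) : 0 < Re z ->
  (1 - Cexp (- z))%C <> 0%C /\ Cmod (/ (1 - Cexp (- z))) <= 1 + / Re z.
Proof.
intros Hz.
assert (H1 : Cmod (Cexp (- z)) = / exp (Re z)).
{ rewrite Cmod_Cexp, <- exp_Ropp; f_equal; now destruct z. }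
assert (H2 : / exp (Re z) <= / (1 + Re z)).
{ apply Rinv_le_contravar; [lra | apply exp_ineq1_le]. }
assert (H3 : 1 - / (1 + Re z) <= Cmod (1 - Cexp (- z))).
{ pose proof (Cmod_triangle (1 - Cexp (- z)) (Cexp (- z))) as H.
  replace (1 - Cexp (- z) + Cexp (- z))%C with (RtoC 1) in H by ring.
  rewrite Cmod_1 in H; lra. }
assert (E : 1 - / (1 + Re z) = / (1 + / Re z)) by (field; lra).
assert (Hi : 0 < / Re z) by now apply Rinv_0_lt_compat.
assert (H4 : 0 < / (1 + / Re z)) by (apply Rinv_0_lt_compat; lra).
assert (H5 : (1 - Cexp (- z))%C <> 0%C) by (apply Cmod_gt_0; lra).
split; trivial; rewrite Cmod_inv by trivial.
rewrite <- (Rinv_inv (1 + / Re z)); apply Rinv_le_contravar; lra.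
Qed.

Section Geometric_expansion.

Variables p a w : C.
Hypothesis Hp : 1 < Re p.
Hypothesis Ha : 0 < Re a.
Hypothesis Hw : 0 < Re w.

(** Closed form of [x^(p-1)] times the sum of [e^(-(w + 2an)x)] over [n >= N]. Thanks to it no
    infinite sum of functions occurs. *)
Definition geom_tail (N : nat) (x : R) : C :=
  (Cpower (RtoC x) (p - 1) * Cexp (- ((w + 2 * a * INR N) * x)) * / (1 - Cexp (- (2 * a * x))))%C.

Lemma Re_double_mult (x : R) : Re (2 * a * x)%C = 2 * Re a * x.
Proof. destruct a; simpl; ring. Qed.

Lemma Re_shift (N : nat) : Re (w + 2 * a * INR N)%C = Re w + 2 * Re a * INR N.
Proof. destruct a, w; simpl; ring. Qed.

Lemma Re_shift_pos (N : nat) : 0 < Re (w + 2 * a * INR N)%C.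
Proof. rewrite Re_shift; pose proof (pos_INR N); nra. Qed.

Lemma Re_double_pos : 0 < Re (2 * a)%C.
Proof. destruct a; simpl in *; lra. Qed.

Lemma denom_neq_0 (x : R) : 0 < x -> (1 - Cexp (- (2 * a * x)))%C <> 0%C.
Proof. intros Hx; apply Cmod_inv_1_minus_Cexp; rewrite Re_double_mult; nra. Qed.

Lemma geom_tail_split (N : nat) (x : R) : 0 < x ->
  geom_tail N x = (Cpower (RtoC x) (p - 1) * Cexp (- ((w + 2 * a * INR N) * x)) + geom_tail (S N) x)%C.
Proof.
intros Hx; unfold geom_tail; rewrite S_INR, RtoC_plus.
replace (- ((w + 2 * a * (INR N + 1)) * x))%C
  with (- ((w + 2 * a * INR N) * x) + - (2 * a * x))%C by ring.
rewrite (Cexp_plus (- ((w + 2 * a * INR N) * x))).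
field; now apply denom_neq_0.
Qed.

Lemma continuousC_geom_tail (N : nat) (x : R) : 0 < x -> continuousC (geom_tail N) x.
Proof.
intros Hx; apply continuousC_mult; [now apply continuousC_Gamma_integrand |].
apply continuousC_inv; [now apply denom_neq_0 |].
apply continuousC_plus; [apply continuousC_const |].
apply continuousC_opp, continuousC_Cexp, continuousC_opp, continuousC_mult.
- apply continuousC_const.
- apply continuousC_RtoC.
Qed.

Lemma geom_tail_bound : exists e K, 0 < e /\ forall N x, 0 < x ->
  Cmod (geom_tail N x) <= K * / Rpower (INR (S N)) e * weight e x.
Proof.
(* [x^(Re p - 1)] is the square of [X = x^e]. One factor gives the decay through
   [X <= M / (N+1)^e * e^(mu (N+1) x)]; the other meets the bound [1 + 1 / (2 Re a x)] of the
   geometric denominator. As [Re w + 2 Re a N >= 2 mu (N+1)], the exponential supplies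
   [e^(-mu (N+1) x)] to the first and [e^(-mu x)] to the second. *)
set (e := (Re p - 1) / 2); set (mu := Rmin (Re w) (2 * Re a) / 2).
assert (He : 0 < e) by (unfold e; lra).
assert (Hmu : 0 < mu /\ 2 * mu <= Re w /\ 2 * mu <= 2 * Re a).
{ pose proof (Rmin_l (Re w) (2 * Re a)); pose proof (Rmin_r (Re w) (2 * Re a)).
  pose proof (Rmin_pos (Re w) (2 * Re a)); unfold mu; lra. }
destruct Hmu as [Hmu [Hmu1 Hmu2]].
destruct (Rpower_exp_bound e mu ltac:(lra) Hmu) as [M [HM HM']].
(* Exponents [0] and [1] serve [X / x] and [X], which arise from the two terms of
   [1 + 1 / (2 Re a x)]. *)
destruct (Rpower_exp_weight 0 e mu ltac:(lra) He Hmu) as [M0 [HM0 HM0']].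
destruct (Rpower_exp_weight 1 e mu ltac:(lra) He Hmu) as [M1 [HM1 HM1']].
exists e, (M * (M1 + M0 / (2 * Re a))); split; trivial; intros N x Hx.
unfold geom_tail; rewrite Cmod_mult, Cmod_Gamma_integrand by trivial.
rewrite Re_shift.
destruct (Cmod_inv_1_minus_Cexp (2 * a * x)) as [_ Hinv]; [rewrite Re_double_mult; nra |].
rewrite Re_double_mult in Hinv.
specialize (HM0' x Hx); specialize (HM1' x Hx).
assert (HN : 0 < INR (S N)) by apply lt_0_INR, Nat.lt_0_succ.
specialize (HM' (INR (S N) * x) ltac:(nra)).
rewrite <- Rpower_mult_distr in HM' by trivial.
set (X := Rpower x e) in *; set (Q := Rpower (INR (S N)) e) in *.
assert (HX : 0 < X) by apply Rpower_pos; assert (HQ : 0 < Q) by apply Rpower_pos.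
assert (Hx' : 0 < / x) by now apply Rinv_0_lt_compat.
assert (E0 : Rpower x (0 + (e - 1)) = X * / x).
{ rewrite Rplus_0_l; unfold Rminus; rewrite Rpower_plus, Rpower_Ropp, Rpower_1; trivial. }
assert (E1 : Rpower x (1 + (e - 1)) = X) by (unfold X; f_equal; ring).
assert (E2 : Rpower x (Re p - 1) = X * X).
{ unfold X; rewrite <- Rpower_plus; f_equal; unfold e; field. }
rewrite E0 in HM0'; rewrite E1 in HM1'; rewrite E2.
assert (Hexp : exp (- ((Re w + 2 * Re a * INR N) * x)) <=
   / exp (mu * (INR (S N) * x)) * exp (- (mu * x))).
{ rewrite <- exp_Ropp, <- exp_plus; apply exp_nondecreasing.
  rewrite S_INR; pose proof (pos_INR N).
  assert (2 * mu * (INR N + 1) <= Re w + 2 * Re a * INR N) by nra.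
  assert (mu * INR N >= 0) by nra.
  assert (mu * (INR N + 1) * x + mu * x <= (Re w + 2 * Re a * INR N) * x) by nra.
  lra. }
set (E := exp (mu * (INR (S N) * x))) in *.
assert (HE : 0 < E) by apply exp_pos.
set (F := exp (- (mu * x))) in *.
assert (HF : 0 < F) by apply exp_pos.
assert (HXE : X * / E <= M * / Q).
{ apply Rmult_le_reg_r with (Q * E); [now apply Rmult_lt_0_compat |].
  replace (X * / E * (Q * E)) with (Q * X) by (field; lra).
  replace (M * / Q * (Q * E)) with (M * E) by (field; lra); trivial. }
apply Rle_trans with (X * X * (/ E * F) * (1 + / (2 * Re a * x))).
{ apply Rmult_le_compat; trivial.
  - apply Rmult_le_pos; [nra | left; apply exp_pos].
  - apply Cmod_ge_0.
  - apply Rmult_le_compat_l; [nra | trivial]. }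
replace (X * X * (/ E * F) * (1 + / (2 * Re a * x)))
  with (X * / E * (X * F + X * / x * F / (2 * Re a))) by (field; lra).
replace (M * (M1 + M0 / (2 * Re a)) * / Q * weight e x)
  with (M * / Q * (M1 * weight e x + M0 * weight e x / (2 * Re a))) by (field; lra).
assert (Ha' : 0 < / (2 * Re a)) by (apply Rinv_0_lt_compat; lra).
assert (HE' : 0 < / E) by now apply Rinv_0_lt_compat.
apply Rmult_le_compat; trivial.
- left; now apply Rmult_lt_0_compat.
- left; apply Rplus_lt_0_compat; [| apply Rdiv_lt_0_compat; [| lra]];
    repeat apply Rmult_lt_0_compat; trivial.
- apply Rplus_le_compat; trivial; now apply Rmult_le_compat_r; [left |].
Qed.

Lemma Cpower_shift (N : nat) :
  (CGamma p / Cpower (w + 2 * a * INR N) p =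
   CGamma p / Cpower (2 * a) p * Cpower (INR N + w / (2 * a)) (- p))%C.
Proof.
pose proof (Re_double_pos) as Ha2.
assert (2 * a <> 0)%C by (intros E; rewrite E in Ha2; simpl in Ha2; lra).
replace (INR N + w / (2 * a))%C with ((w + 2 * a * INR N) / (2 * a))%C.
2:{ field; intros E; apply H; rewrite E; ring. }
rewrite Cpower_opp, Cpower_div by (trivial; apply Re_shift_pos).
field; split; apply Cpower_neq_0.
Qed.

(** With [l N] the integral of the tail, peeling one term gives [l N = D * z N + l (S N)]. Thus [D]
    times a partial sum is [l O - l (S N)], which tends to [l O] by the tail bound and to [D] times
    the zeta value by convergence of the series. *)
Lemma is_RInt_gen_geometric :
  is_RInt_genC (geom_tail 0) (CGamma p / Cpower (2 * a) p * Hurwitz_zeta p (w / (2 * a)))%C.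
Proof.
destruct geom_tail_bound as [e [K [He HK]]].
assert (Hex : exists l : nat -> C, forall N,
  is_RInt_genC (geom_tail N) (l N) /\ Cmod (l N) <= K * / Rpower (INR (S N)) e / e).
{ exists (fun N => RInt_gen (V := C_R_CompleteNormedModule) (geom_tail N) (at_right 0)
                     (Rbar_locally p_infty)).
  intros N.
  destruct (is_RInt_gen_weight (geom_tail N) e (K * / Rpower (INR (S N)) e) He) as [y [Hy Hb]].
  - apply continuousC_geom_tail.
  - intros x Hx; now apply HK.
  - rewrite (is_RInt_gen_unique (V := C_R_CompleteNormedModule) _ _ Hy); now split. }
destruct Hex as [l Hl].
set (D := (CGamma p / Cpower (2 * a) p)%C).
set (z := fun n : nat => Cpower (INR n + w / (2 * a)) (- p)).
assert (Hstep : forall N, l N = (D * z N + l (S N))%C).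
{ intros N; apply (is_RInt_genC_unique (geom_tail N)); [apply Hl |].
  unfold D, z; rewrite <- Cpower_shift.
  apply is_RInt_genC_ext with
    (fun x => (Cpower (RtoC x) (p - 1) * Cexp (- ((w + 2 * a * INR N) * x)) + geom_tail (S N) x)%C).
  { intros x Hx; symmetry; now apply geom_tail_split. }
  apply (is_RInt_gen_plus (V := C_R_NormedModule)); [| apply Hl].
  apply is_RInt_gen_CGamma_scaled; trivial; apply Re_shift_pos. }
assert (Hsum : forall N, (D * sum_n (G := C_R_NormedModule) z N)%C = (l O - l (S N))%C).
{ intros N; induction N as [|N IH].
  - rewrite sum_O, (Hstep O); ring.
  - rewrite sum_Sn.
    change (D * (sum_n (G := C_R_NormedModule) z N + z (S N)) = l O - l (S (S N)))%C.
    rewrite Cmult_plus_distr_l, IH, (Hstep (S N)); ring. }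
(* Convergence of [D * sum_n z] would give that of [sum_n z] only for nonzero [D], so the series is
   treated directly. *)
assert (Hser : is_series (V := C_R_NormedModule) z (Hurwitz_zeta p (w / (2 * a)))).
{ pose proof Re_double_pos as Ha2.
  assert (Hne : (2 * a)%C <> 0%C) by (intros E; rewrite E in Ha2; simpl in Ha2; lra).
  assert (Hm := proj1 (Cmod_gt_0 _) Hne).
  (* The constant comes from [n + w / (2a) = (w + 2an) / (2a)] and
     [|w + 2an| >= Re (w + 2an) >= 2 Re a n]. *)
  apply is_series_Hurwitz_zeta, (ex_series_Hurwitz _ _ (2 * Re a / Cmod (2 * a))); trivial.
  - apply Rdiv_lt_0_compat; lra.
  - intros n.
    replace (INR n + w / (2 * a))%C with ((w + 2 * a * INR n) / (2 * a))%C.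
    2:{ field; intros E; apply Hne; rewrite E; ring. }
    rewrite Cmod_div by trivial.
    replace (2 * Re a / Cmod (2 * a) * INR n) with (2 * Re a * INR n / Cmod (2 * a))
      by (field; lra).
    apply Rmult_le_compat_r; [left; now apply Rinv_0_lt_compat |].
    eapply Rle_trans; [| apply re_le_Cmod]; eapply Rle_trans; [| apply Rle_abs].
    rewrite Re_shift; lra. }
assert (Hlim0 : filterlim (fun N => (l O - l (S N))%C) eventually
   (locally (T := C_R_NormedModule) (l O))).
{ apply (filterlim_locally_ball_norm (U := C_R_NormedModule)); intros eps.
  pose proof (cond_pos eps).
  (* Beyond this threshold [(N+2)^e * e * eps > |K| + 1 > K]; the [1] keeps the base of the power
     positive even if [K = 0]. *)
  generalize (is_lim_seq_INR _ (Rbar_locally_p_infty_lt (Rpower ((Rabs K + 1) / (e * eps)) (/ e)))).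
  unfold filtermap; apply filter_imp; intros N HN.
  unfold ball_norm; rewrite <- Cmod_norm.
  change (Cmod (l O - l (S N) - l O) < eps).
  replace (l O - l (S N) - l O)%C with (- l (S N))%C by ring.
  rewrite Cmod_opp; eapply Rle_lt_trans; [apply Hl |].
  assert (Hq : 0 < (Rabs K + 1) / (e * eps)).
  { pose proof (Rabs_pos K); apply Rdiv_lt_0_compat; [lra | now apply Rmult_lt_0_compat]. }
  assert (HP : (Rabs K + 1) / (e * eps) < Rpower (INR (S (S N))) e).
  { set (q := (Rabs K + 1) / (e * eps)) in *.
    rewrite <- (Rpower_1 q), <- (Rinv_l e), <- Rpower_mult by lra.
    apply Rlt_Rpower_l; trivial; split; [apply Rpower_pos | rewrite !S_INR; lra]. }
  set (P := Rpower (INR (S (S N))) e) in *.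
  apply Rmult_lt_reg_r with (P * e); [apply Rmult_lt_0_compat; lra |].
  replace (K * / P / e * (P * e)) with K by (field; lra).
  apply Rmult_lt_compat_r with (r := e * eps) in HP; [| now apply Rmult_lt_0_compat].
  replace ((Rabs K + 1) / (e * eps) * (e * eps)) with (Rabs K + 1) in HP by (field; lra).
  pose proof (Rle_abs K); lra. }
assert (Hlim1 : filterlim (fun N => (l O - l (S N))%C) eventually
   (locally (T := C_R_NormedModule) (D * Hurwitz_zeta p (w / (2 * a)))%C)).
{ apply (filterlim_ext (fun N => (D * sum_n (G := C_R_NormedModule) z N)%C)); [exact Hsum |].
  exact (filterlim_comp _ _ _ _ _ _ _ _ Hser (filterlim_scal_r (V := C_NormedModule) D _)). }
rewrite <- (filterlim_locally_unique (V := C_R_NormedModule) _ _ _ Hlim0 Hlim1).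
apply Hl.
Qed.

End Geometric_expansion.

Theorem lemma1 (p a b : C)
    (hp : (1 < Re p)%R)
    (ha : (0 < Re a)%R)
    (hab : (Rabs (Re b) < Rabs (Re a))%R) :
  is_RInt_gen (V := C_R_NormedModule)
    (fun x : R =>
       (Ccosh (b * RtoC x) / Csinh (a * RtoC x) * Cpower (RtoC x) (p - 1))%C)
    (at_right 0) (Rbar_locally p_infty)
    (CGamma p / Cpower (2 * a) p *
       (Hurwitz_zeta p ((a - b) / (2 * a)) +
        Hurwitz_zeta p ((a + b) / (2 * a))))%C.
Proof.
rewrite (Rabs_pos_eq (Re a)) in hab by lra; apply Rabs_lt_between in hab.
assert (H1 : 0 < Re (a - b)%C) by (destruct a, b; simpl in *; lra).
assert (H2 : 0 < Re (a + b)%C) by (destruct a, b; simpl in *; lra).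
rewrite Cmult_plus_distr_l.
(* Multiplying numerator and denominator by [e^(-ax)] turns [cosh bx / sinh ax] into [(e^(-(a-b)x) +
   e^(-(a+b)x)) / (1 - e^(-2ax))], two full geometric series. *)
apply is_RInt_genC_ext with (fun x => (geom_tail p a (a - b) 0 x + geom_tail p a (a + b) 0 x)%C).
- intros x Hx; unfold geom_tail; simpl INR.
  pose proof (denom_neq_0 a ha x Hx) as Hne.
  replace (- ((a - b + 2 * a * 0) * x))%C with (b * x + - (a * x))%C by ring.
  replace (- ((a + b + 2 * a * 0) * x))%C with (- (b * x) + - (a * x))%C by ring.
  replace (- (2 * a * x))%C with (- (a * x) + - (a * x))%C in * by ring.
  rewrite Cexp_plus, Cexp_opp in Hne.
  unfold Ccosh, Csinh; rewrite !Cexp_plus, !Cexp_opp.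
  pose proof (Cexp_neq_0 (a * x)); pose proof (Cexp_neq_0 (b * x)).
  set (A := Cexp (a * x)) in *; set (B := Cexp (b * x)) in *.
  (* This is [sinh ax <> 0] in the form that [field] requires; it amounts to [1 - e^(-2ax) <> 0]
     multiplied by [A * A]. *)
  assert (A * A - 1 <> 0)%C.
  { intros E; apply Hne; replace (1 - / A * / A)%C with ((A * A - 1) * (/ A * / A))%C.
    - rewrite E; ring.
    - field; trivial. }
  field; repeat split; trivial.
- now apply (is_RInt_gen_plus (V := C_R_NormedModule)); apply is_RInt_gen_geometric.
Qed.
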